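(* Let $((\mathfrak g,[\cdot,\cdot]_{\mathfrak g}),(V;\rho),T)$ be a Lie-Leibniz triple, and let $\mathfrak C^n(\mathfrak g,\rho,T)$ and $\mathcal D:\mathfrak C^n(\mathfrak g,\rho,T)\to\mathfrak C^{n+1}(\mathfrak g,\rho,T)$ be the spaces and the operator defined in the context. Then $\big(\bigoplus_{n\ge0}\mathfrak C^n(\mathfrak g,\rho,T),\mathcal D\big)$ is a cochain complex, i.e. $\mathcal D\circ\mathcal D=0$.
   Context: A Lie-Leibniz triple $((\mathfrak g,[\cdot,\cdot]_{\mathfrak g}),(V;\rho),T)$ consists of a Lie algebra $\mathfrak g$ over a field, a representation $\rho:\mathfrak g\to\mathfrak{gl}(V)$, and a linear map $T:V\to\mathfrak g$ with $[Tu,Tv]_{\mathfrak g}=T(\rho(Tu)v)$ for all $u,v\in V$. Put $\mathfrak C^0(\mathfrak g,\rho,T)=0$ and for $n\ge1$ $$\mathfrak C^n(\mathfrak g,\rho,T)=\mathfrak C^n(\mathfrak g,\rho)\oplus\mathfrak C^n(T),\quad \mathfrak C^n(\mathfrak g,\rho)=\mathrm{Hom}(\wedge^n\mathfrak g,\mathfrak g)\oplus\mathrm{Hom}(\wedge^{n-1}\mathfrak g\otimes V,V),\quad \mathfrak C^n(T)=\mathrm{Hom}(\otimes^{n-1}V,\mathfrak g)$$ (with $\mathfrak C^1(T)=\mathfrak g$). For $f=(f_{\mathfrak g},f_V)\in\mathfrak C^n(\mathfrak g,\rho)$ and $\theta\in\mathfrak C^n(T)$ set $\mathcal D(f,\theta)=(\delta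 f,\ \partial_T\theta+\Omega_Tf)$, where: (1) $\delta f=((\delta f)_{\mathfrak g},(\delta f)_V)$ with $(\delta f)_{\mathfrak g}=\mathrm d_{CE}f_{\mathfrak g}$, the Chevalley-Eilenberg coboundary for the adjoint representation, $$\mathrm d_{CE}f_{\mathfrak g}(x_1,\dots,x_{n+1})=\sum_{i=1}^{n+1}(-1)^{i+1}[x_i,f_{\mathfrak g}(x_1,\dots,\hat x_i,\dots,x_{n+1})]_{\mathfrak g}+\sum_{i<j}(-1)^{i+j}f_{\mathfrak g}([x_i,x_j]_{\mathfrak g},x_1,\dots,\hat x_i,\dots,\hat x_j,\dots,x_{n+1}),$$ $$\begin{aligned}(\delta f)_V(x_1,\dots,x_n,v)=&\sum_{1\le i<j\le n}(-1)^if_V(x_1,\dots,\hat x_i,\dots,x_{j-1},[x_i,x_j]_{\mathfrak g},x_{j+1},\dots,x_n,v)+(-1)^{n-1}\rho(f_{\mathfrak g}(x_1,\dots,x_n))v\\&+\sum_{i=1}^n(-1)^{i+1}\big(\rho(x_i)f_V(x_1,\dots,\hat x_i,\dots,x_n,v)-f_V(x_1,\dots,\hat x_i,\dots,x_n,\rho(x_i)v)\big).\end{aligned}$$ (2) For $\theta\in\mathrm{Hom}(\otimes^kV,\mathfrak g)$, $k\ge0$, $$\begin{aligned}\partial_T\theta(u_1,\dots,u_{k+1})=&\sum_{i=1}^k(-1)^{i+1}[Tu_i,\theta(u_1,\dots,\hat u_i,\dots,u_{k+1})]_{\mathfrak g}+(-1)^{k+1}[\theta(u_1,\dots,u_k),Tu_{k+1}]_{\mathfrak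 g}\\&+(-1)^kT(\rho(\theta(u_1,\dots,u_k))u_{k+1})+\sum_{1\le i<j\le k+1}(-1)^i\theta(u_1,\dots,\hat u_i,\dots,u_{j-1},\rho(Tu_i)u_j,u_{j+1},\dots,u_{k+1}).\end{aligned}$$ (3) $\Omega_T(f_{\mathfrak g},f_V)(v_1,\dots,v_n)=(-1)^n\big(f_{\mathfrak g}(Tv_1,\dots,Tv_n)-Tf_V(Tv_1,\dots,Tv_{n-1},v_n)\big)$. *)

(* Defs.v *)
From HB Require Import structures.
From mathcomp Require Import all_boot all_algebra.
From mathcomp Require Import sesquilinear.
From mathcomp Require Import boolp classical_sets functions.

Set Implicit Arguments.
Unset Strict Implicit.
Unset Printing Implicit Defensive.

Import GRing.Theory.
Local Open Scope ring_scope.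

Record lieAlgebra (K : fieldType) := LieAlgebra {
  lie_sort :> lmodType K;
  lie_br : {bilinear lie_sort -> lie_sort -> lie_sort};
  lie_brxx : forall x, lie_br x x = 0;
  lie_jacobi : forall x y z,
    lie_br x (lie_br y z) + lie_br y (lie_br z x) + lie_br z (lie_br x y) = 0
}.

Notation "[[ x , y ]]" := (lie_br _ x y)
  (at level 0, x at level 99, y at level 99, format "[[ x ,  y ]]") : ring_scope.

(* [rho x] is the endomorphism [v |-> rho x v] of [V]. *)
Record lieRep (K : fieldType) (g : lieAlgebra K) (V : lmodType K) := LieRep {
  rep_act :> {bilinear g -> V -> V};
  rep_br : forall (x y : g) (v : V),
    rep_act [[x, y]] v = rep_act x (rep_act y v) - rep_act y (rep_act x v)
}.

(* The identity making (g, rho, T) a Lie-Leibniz triple. *)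
Definition embedding_tensor (K : fieldType) (g : lieAlgebra K) (V : lmodType K)
    (rho : lieRep g V) (T : {linear V -> g}) : Prop :=
  forall u v : V, [[T u, T v]] = T (rho (T u) v).

(* Argument lists (x_1, ..., x_n) are functions on 'I_n, indexed from 0. *)
Section Args.
Variables (A : Type) (n : nat).

Definition cons_arg (a : A) (x : 'I_n -> A) (k : 'I_n.+1) : A :=
  if unlift ord0 k is Some l then x l else a.

Definition omit (i : 'I_n.+1) (x : 'I_n.+1 -> A) (k : 'I_n) : A := x (lift i k).

Definition set_arg (i : 'I_n) (a : A) (x : 'I_n -> A) (k : 'I_n) : A :=
  if k == i then a else x k.

End Args.

Definition multilinear (K : fieldType) (U W : lmodType K) n
    (f : ('I_n -> U) -> W) : Prop :=
  forall (i : 'I_n) (x : 'I_n -> U), linear (fun u => f (set_arg i u x)).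

Definition alternating (K : fieldType) (U W : lmodType K) n
    (f : ('I_n -> U) -> W) : Prop :=
  forall (x : 'I_n -> U) (i j : 'I_n), i != j -> x i = x j -> f x = 0.

Section Cochains.
Variables (K : fieldType) (g : lieAlgebra K) (V : lmodType K).

(* Degree n+1: all functions of the right arity, a vector space in which
   [C] below carves out the subspace of actual cochains. *)
Definition preC_rep n : lmodType K :=
  ((('I_n.+1 -> g) -> g) * (('I_n -> g) -> V -> V))%type.
Definition preC_T n : lmodType K := ('I_n -> V) -> g.

(* Degree 0 is the zero space. *)
Definition preC (n : nat) : lmodType K :=
  if n is m.+1 then (preC_rep m * preC_T m)%type else 'rV[K]_0.

Definition C_rep n (f : preC_rep n) : Prop :=
  [/\ multilinear f.1, alternating f.1,
      forall v, multilinear (f.2^~ v),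
      forall v, alternating (f.2^~ v)
    & forall x, linear (f.2 x)].

Definition C_T n (theta : preC_T n) : Prop := multilinear theta.

Definition C (n : nat) : set (preC n) :=
  match n return set (preC n) with
  | 0 => setT
  | m.+1 => [set c : preC_rep m * preC_T m | C_rep c.1 /\ C_T c.2]
  end.

Variables (rho : lieRep g V) (T : {linear V -> g}).

(* In the double sums below, the pair i < j of positions is encoded by
   (i, j') with i <= j' and j = lift i j' = j' + 1: j' is the position of
   x_j once x_i has been omitted.  With 1-based i and j as in the usual
   formulas, (-1)^i is (-1) ^+ i.+1 and (-1)^(i+j) is (-1) ^+ (i + j').+1. *)

Definition dCE n (f : ('I_n.+1 -> g) -> g) (x : 'I_n.+2 -> g) : g :=
  \sum_(i < n.+2) (-1) ^+ i *: [[x i, f (omit i x)]]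
  + \sum_(i < n.+2) \sum_(j < n.+1 | (i <= j)%N)
      (-1) ^+ (i + j).+1 *:
      f (cons_arg [[x i, x (lift i j)]] (omit j (omit i x))).

Definition delta_V n (f : preC_rep n) (x : 'I_n.+1 -> g) (v : V) : V :=
  \sum_(i < n.+1) \sum_(j < n | (i <= j)%N)
      (-1) ^+ i.+1 *: f.2 (set_arg j [[x i, x (lift i j)]] (omit i x)) v
  + (-1) ^+ n *: rho (f.1 x) v
  + \sum_(i < n.+1)
      (-1) ^+ i *: (rho (x i) (f.2 (omit i x) v) - f.2 (omit i x) (rho (x i) v)).

Definition delta n (f : preC_rep n) : preC_rep n.+1 := (dCE f.1, delta_V f).

Definition partial_T k (theta : preC_T k) : preC_T k.+1 := fun u =>
  \sum_(i < k) (-1) ^+ i *: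
      [[T (u (lift ord_max i)), theta (omit (lift ord_max i) u)]]
  + (-1) ^+ k.+1 *: [[theta (omit ord_max u), T (u ord_max)]]
  + (-1) ^+ k *: T (rho (theta (omit ord_max u)) (u ord_max))
  + \sum_(i < k.+1) \sum_(j < k | (i <= j)%N)
      (-1) ^+ i.+1 *:
      theta (set_arg j (rho (T (u i)) (u (lift i j))) (omit i u)).

Definition Omega_T n (f : preC_rep n) : preC_T n.+1 := fun v =>
  (-1) ^+ n.+1 *:
  (f.1 (T \o v) - T (f.2 (T \o omit ord_max v) (v ord_max))).

Definition D (n : nat) : preC n -> preC n.+1 :=
  match n return preC n -> preC n.+1 with
  | 0 => fun=> 0
  | m.+1 => fun c : preC_rep m * preC_T m =>
      (delta c.1, partial_T c.2 + Omega_T c.1)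
  end.

End Cochains.

(* The subspaces [C n] of the ambient spaces [A n], with the restrictions of
   the maps [d n], form a cochain complex of vector spaces. *)
Record cochain_complex (K : fieldType) (A : nat -> lmodType K)
    (C : forall n, set (A n)) (d : forall n, A n -> A n.+1) : Prop := {
  cochain0 : forall n, C n 0;
  cochainP : forall n (a : K) (b c : A n), C n b -> C n c -> C n (a *: b + c);
  cochain_d : forall n (c : A n), C n c -> C n.+1 (d n c);
  cochain_d_linear : forall n (a : K) (b c : A n),
    C n b -> C n c -> d n (a *: b + c) = a *: d n b + d n c;
  cochain_dd : forall n (c : A n), C n c -> d n.+1 (d n c) = 0
}.

(* Main.v *)
(* All the coboundaries involved are instances of the Loday-Pirashvili
   differential [d] of a left Leibniz algebra with values in a bimodule, which
   satisfies Cartan's formula [i_x d = L_x - d i_x], where [i_x] inserts [x] as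
   first argument.  By induction on the degree, [L_x] commutes with [d], whence
   [d d = 0]: [i_x d d = L_x d - d L_x + d d i_x].

   A pair (f_g, f_V) is the cochain
     ((x_1, v_1), .., (x_n, v_n)) |->
       (f_g(x_1, .., x_n), f_V(x_1, .., x_(n-1), v_n))
   of the hemisemidirect product g * V, with bracket
   [(x, u), (y, v)] = ([x, y], rho(x) v), in its adjoint bimodule, and [delta]
   is its differential.  Since T is an embedding tensor, u |-> (T u, u)
   identifies V, with [u, v] = rho(T u) v, with a Leibniz subalgebra of g * V,
   and (x, v) |-> x - T v identifies the quotient bimodule with g; [partial_T]
   is the resulting differential.  Up to sign, [Omega_T] is restriction to the
   subalgebra followed by projection to the quotient, so by naturality it
   commutes with the differentials up to sign, and D D = 0. *)

Require Import Defs.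
From mathcomp Require Import all_boot all_algebra.
From mathcomp Require Import sesquilinear boolp classical_sets functions zify.
Local Open Scope ring_scope.
Set Implicit Arguments.
Unset Strict Implicit.
Unset Printing Implicit Defensive.
Import GRing.Theory.

(** * Cancellation in abelian groups *)

(* Convertible summands may differ in their implicit structure arguments, and
   are first identified by naming them. *)
Ltac name_summands s :=
  lazymatch s with
  | @Algebra.add _ ?x ?y => first [name_summands x | name_summands y]
  | @Algebra.opp _ ?x => name_summands x
  | @Algebra.zero _ => fail
  | _ => tryif is_var s then fail else
           (let t := fresh "t" in set t := s; clearbody t)
  end.

Ltac pull_term t r :=
  lazymatch r with
  | t => idtac
  | @Algebra.add _ t _ => idtac
  | @Algebra.add _ ?y t => rewrite (addrC y t)
  | @Algebra.add _ ?y ?r' => pull_term t r'; rewrite (addrCA y t)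
  end.

Ltac pull_opp x r :=
  lazymatch r with
  | context [@Algebra.opp ?G x] => pull_term (@Algebra.opp G x) r
  end.

Ltac cancel_summands :=
  lazymatch goal with
  | |- @eq _ (@Algebra.add _ (@Algebra.opp _ ?x) ?r) _ =>
      pull_term x r; rewrite ?addKr ?addNr; cancel_summands
  | |- @eq _ (@Algebra.add _ ?x ?r) _ =>
      pull_opp x r; rewrite ?addNKr ?subrr; cancel_summands
  | |- _ => reflexivity
  end.

(** Proves equations in an abelian group: everything is moved to the left-hand side, and each
    leading summand is cancelled against its opposite. Scalar multiples count as atoms. *)
Ltac zmod :=
  repeat (match goal with
          | |- @eq _ ?s _ => name_summands s
          | |- @eq _ _ ?s => name_summands s
          end);
  apply/eqP; rewrite -subr_eq0; apply/eqP;
  rewrite ?(opprD, opprK, addr0, add0r, subr0, sub0r, oppr0) -?addrA;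
  cancel_summands.

(** * Omitting several positions, and operations on argument lists *)

Lemma lift_lift n (i : 'I_n.+1) (j : 'I_n) :
  lift (lift ord0 i) (lift ord0 j) = lift ord0 (lift i j).
Proof. by apply: val_inj; rewrite /= /bump; lia. Qed.

Lemma lift_lift0 n (i : 'I_n.+1) : lift (lift ord0 i) ord0 = ord0.
Proof. exact: val_inj. Qed.

Lemma lift_max0 n : lift ord_max ord0 = ord0 :> 'I_n.+2.
Proof. exact: val_inj. Qed.

Lemma lift_max_lift n (i : 'I_n) :
  lift ord_max (lift ord0 i) = lift ord0 (lift ord_max i).
Proof. by apply: val_inj; rewrite /= /bump; have := ltn_ord i; lia. Qed.

Lemma lift0_max n : lift ord0 ord_max = ord_max :> 'I_n.+2.
Proof. exact: val_inj. Qed.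

Lemma lift_max_max n (i : 'I_n.+1) : lift (lift ord_max i) ord_max = ord_max.
Proof. by apply: val_inj; rewrite /= /bump; have := ltn_ord i; lia. Qed.

Lemma lift_max_lift_max n (i : 'I_n.+1) (j : 'I_n) :
  lift (lift ord_max i) (lift ord_max j) = lift ord_max (lift i j).
Proof.
apply: val_inj; rewrite /= /bump.
by have := ltn_ord i; have := ltn_ord j; lia.
Qed.

Lemma widen_lift n (i : 'I_n) : widen_ord (leqnSn n) i = lift ord_max i.
Proof. by apply: val_inj; rewrite [RHS]lift_max. Qed.

Section ArgumentLists.
Variable A : Type.

Lemma cons_arg_ord0 n a (x : 'I_n -> A) : cons_arg a x ord0 = a.
Proof. by rewrite /cons_arg unlift_none. Qed.

Lemma cons_arg_lift n a (x : 'I_n -> A) i : cons_arg a x (lift ord0 i) = x i.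
Proof. by rewrite /cons_arg liftK. Qed.

Lemma cons_arg_omit n (x : 'I_n.+1 -> A) : cons_arg (x ord0) (omit ord0 x) = x.
Proof.
apply/funext => k; case: (unliftP ord0 k) => [j|] ->.
  by rewrite cons_arg_lift.
by rewrite cons_arg_ord0.
Qed.

Lemma omit0_cons_arg n a (x : 'I_n -> A) : omit ord0 (cons_arg a x) = x.
Proof. by apply/funext => k; rewrite /omit cons_arg_lift. Qed.

Lemma omit_cons_arg n a (x : 'I_n.+1 -> A) i :
  omit (lift ord0 i) (cons_arg a x) = cons_arg a (omit i x).
Proof.
apply/funext => k; rewrite /omit.
case: (unliftP ord0 k) => [j|] ->.
  by rewrite lift_lift !cons_arg_lift.
by rewrite lift_lift0 !cons_arg_ord0.
Qed.

Lemma set_arg0_cons_arg n a b (x : 'I_n -> A) :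
  set_arg ord0 b (cons_arg a x) = cons_arg b x.
Proof.
apply/funext => k; rewrite /set_arg.
case: (unliftP ord0 k) => [j|] ->.
  by rewrite eq_sym (negPf (neq_lift _ _)) !cons_arg_lift.
by rewrite !cons_arg_ord0 eqxx.
Qed.

Lemma set_arg_cons_arg n a b (x : 'I_n -> A) i :
  set_arg (lift ord0 i) b (cons_arg a x) = cons_arg a (set_arg i b x).
Proof.
apply/funext => k; rewrite /set_arg.
case: (unliftP ord0 k) => [j|] ->; last by rewrite !cons_arg_ord0.
by rewrite !cons_arg_lift (inj_eq lift_inj).
Qed.

Lemma set_arg_same n (x : 'I_n -> A) i b c :
  set_arg i b (set_arg i c x) = set_arg i b x.
Proof. by apply/funext => k; rewrite /set_arg; case: eqP. Qed.

Lemma set_argC n (x : 'I_n -> A) i j b c : i != j ->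
  set_arg i b (set_arg j c x) = set_arg j c (set_arg i b x).
Proof.
move=> nij; apply/funext => k; rewrite /set_arg.
by case: (eqVneq k i) => // ->; rewrite (negPf nij).
Qed.

Lemma set_arg_id n (x : 'I_n -> A) i : set_arg i (x i) x = x.
Proof. by apply/funext => k; rewrite /set_arg; case: eqP => // ->. Qed.

Lemma set_arg_eq n (x : 'I_n -> A) i b : set_arg i b x i = b.
Proof. by rewrite /set_arg eqxx. Qed.

Lemma set_arg_neq n (x : 'I_n -> A) i j b : j != i -> set_arg i b x j = x j.
Proof. by rewrite /set_arg => /negPf ->. Qed.

Lemma args0_eq (x y : 'I_0 -> A) : x = y.
Proof. by apply/funext => -[]. Qed.

Lemma omit_max_omit n (x : 'I_n.+2 -> A) i :
  omit ord_max (omit (lift ord_max i) x) = omit i (omit ord_max x).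
Proof. by apply/funext => k; rewrite /omit lift_max_lift_max. Qed.

Lemma omit_lift_max n (x : 'I_n.+2 -> A) i :
  omit (lift ord_max i) x ord_max = x ord_max.
Proof. by rewrite /omit lift_max_max. Qed.

Lemma omit_max_set_arg n (x : 'I_n.+1 -> A) i b :
  omit ord_max (set_arg (lift ord_max i) b x) = set_arg i b (omit ord_max x).
Proof.
by apply/funext => k; rewrite /omit /set_arg (inj_eq lift_inj).
Qed.

Lemma omit_max_set_arg_max n (x : 'I_n.+1 -> A) b :
  omit ord_max (set_arg ord_max b x) = omit ord_max x.
Proof. by apply/funext => k; rewrite /omit set_arg_neq // eq_sym neq_lift. Qed.

End ArgumentLists.

Lemma comp_omit (A B : Type) (h : A -> B) n (i : 'I_n.+1) x :
  h \o omit i x = omit i (h \o x).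
Proof. by []. Qed.

Lemma comp_set_arg (A B : Type) (h : A -> B) n (i : 'I_n) a x :
  h \o set_arg i a x = set_arg i (h a) (h \o x).
Proof. by apply/funext => k; rewrite /= /set_arg; case: eqP. Qed.

(** * Linear maps as bare functions satisfying [linear] *)

Section LinearPredicate.
Variables (K : fieldType) (U W : lmodType K) (f : U -> W).
Hypothesis linf : linear f.

Lemma linear_predD u v : f (u + v) = f u + f v.
Proof. by have := linf 1 u v; rewrite !scale1r. Qed.

Lemma linear_pred0 : f 0 = 0.
Proof. by apply: (addrI (f 0)); rewrite -linear_predD !addr0. Qed.

Lemma linear_predZ a u : f (a *: u) = a *: f u.
Proof. by have := linf a u 0; rewrite !addr0 linear_pred0 addr0. Qed.

Lemma linear_predN u : f (- u) = - f u.
Proof. by rewrite -scaleN1r linear_predZ scaleN1r. Qed.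

Lemma linear_predB u v : f (u - v) = f u - f v.
Proof. by rewrite linear_predD linear_predN. Qed.

Lemma linear_pred_sum I (s : seq I) (P : pred I) (F : I -> U) :
  f (\sum_(i <- s | P i) F i) = \sum_(i <- s | P i) f (F i).
Proof. exact: (big_morph f linear_predD linear_pred0). Qed.

End LinearPredicate.

Section LinearClosure.
Variables (K : fieldType) (U W : lmodType K).

Lemma linear_predB_fun (f h : U -> W) :
  linear f -> linear h -> linear (fun u => f u - h u).
Proof. by move=> lf lh a u v; rewrite lf lh scalerBr opprD addrACA. Qed.

Lemma linear_predD_fun (f h : U -> W) :
  linear f -> linear h -> linear (fun u => f u + h u).
Proof. by move=> lf lh a u v; rewrite lf lh scalerDr addrACA. Qed.

Lemma linear_predZ_fun (c : K) (f : U -> W) :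
  linear f -> linear (fun u => c *: f u).
Proof. by move=> lf a u v; rewrite lf scalerDr !scalerA mulrC. Qed.

Lemma linear_pred_sum_fun I (s : seq I) (P : pred I) (F : I -> U -> W) :
  (forall i, P i -> linear (F i)) ->
  linear (fun u => \sum_(i <- s | P i) F i u).
Proof.
move=> lF a u v; rewrite scaler_sumr -big_split; apply: eq_bigr => i Pi.
exact: lF.
Qed.

End LinearClosure.

(** * Multilinear and alternating functions *)

Section Multilinear.
Variables (K : fieldType) (L M : lmodType K).

(** The contraction i_y. Inductions on the degree below apply it to both sides of an identity and
    conclude by [eq_ins]. *)
Definition ins n (y : L) (f : ('I_n.+1 -> L) -> M) (x : 'I_n -> L) : M :=
  f (cons_arg y x).

Lemma eq_ins n (f h : ('I_n.+1 -> L) -> M) :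
  (forall y, ins y f = ins y h) -> f = h.
Proof.
move=> E; apply/funext => x; rewrite -[x]cons_arg_omit.
by have /(congr1 (@^~ (omit ord0 x))) := E (x ord0).
Qed.

Lemma ins_multilinear n y (f : ('I_n.+1 -> L) -> M) :
  multilinear f -> multilinear (ins y f).
Proof.
move=> mf i x a u v; rewrite /ins -!set_arg_cons_arg; exact: mf.
Qed.

Lemma ins_alternating n y (f : ('I_n.+1 -> L) -> M) :
  alternating f -> alternating (ins y f).
Proof.
move=> af x i j nij xij.
by apply: (af _ (lift ord0 i) (lift ord0 j));
  rewrite ?(inj_eq lift_inj) // !cons_arg_lift.
Qed.

Lemma ins_linear n (f : ('I_n.+1 -> L) -> M) :
  multilinear f -> linear (fun y => ins y f).
Proof.
move=> mf a u v; apply/funext => x; rewrite /ins.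
have := mf ord0 (cons_arg 0 x) a u v.
by rewrite !set_arg0_cons_arg.
Qed.

(** Polarization: with u + v at both positions, only the two mixed terms survive the expansion. *)
Lemma alternating_swap n (f : ('I_n -> L) -> M) i j u v x :
  multilinear f -> alternating f -> i != j ->
  f (set_arg i u (set_arg j v x)) = - f (set_arg i v (set_arg j u x)).
Proof.
move=> mf af nij; apply/eqP; rewrite -addr_eq0; apply/eqP.
have z w : f (set_arg i w (set_arg j w x)) = 0.
  apply: (af _ i j nij).
  by rewrite set_arg_eq set_arg_neq 1?eq_sym // set_arg_eq.
have := z (u + v).
rewrite (linear_predD (mf i _)) !(set_argC _ _ _ nij).
rewrite !(linear_predD (mf j _)) -!(set_argC _ _ _ nij) !z addr0 add0r.
by [].
Qed.

Lemma alternating_swap_cons n (f : ('I_n.+1 -> L) -> M) i u v x :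
  multilinear f -> alternating f ->
  f (cons_arg u (set_arg i v x)) = - f (cons_arg v (set_arg i u x)).
Proof.
move=> mf af.
(* The 0 is a placeholder that [set_arg ord0] overwrites. *)
have := alternating_swap u v (cons_arg 0 x) mf af (neq_lift ord0 i).
by rewrite !set_arg_cons_arg !set_arg0_cons_arg.
Qed.

(* Moving the first argument to position [j] is a cycle of length [j + 1]. *)
Lemma alternating_cycle n (f : ('I_n.+1 -> L) -> M) b j x :
  multilinear f -> alternating f ->
  f (cons_arg b (omit j x)) = (-1) ^+ j *: f (set_arg j b x).
Proof.
elim: n => [|n IH] in f j x *; move=> mf af.
  rewrite -[x]cons_arg_omit ord1 omit0_cons_arg set_arg0_cons_arg.
  by rewrite expr0 scale1r.
rewrite -[x]cons_arg_omit; move: (x _) (omit _ x) => {x} y x.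
case: (unliftP ord0 j) => [k|] ->.
  (* For j = k + 1, exchanging b with the head y gives one sign, and the induction hypothesis for
     [ins y f] carries b on to position k. *)
  rewrite omit_cons_arg set_arg_cons_arg -(cons_arg_omit (cons_arg y _)).
  have := alternating_swap_cons ord0 b y (cons_arg 0 (omit k x)) mf af.
  rewrite !set_arg0_cons_arg cons_arg_ord0 omit0_cons_arg => ->.
  have := IH (ins y f) k x (ins_multilinear y mf) (ins_alternating y af).
  by rewrite /ins => ->; rewrite exprS mulN1r scaleNr.
by rewrite omit0_cons_arg set_arg0_cons_arg expr0 scale1r.
Qed.

End Multilinear.

(** * The Loday-Pirashvili differential and the Lie derivative *)

Section Differential.
Variables (K : fieldType) (L M : lmodType K).
Variables (br : L -> L -> L) (l : L -> M -> M) (r : M -> L -> M).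

Definition ld n (f : ('I_n -> L) -> M) (u : 'I_n.+1 -> L) : M :=
  \sum_(i < n) (-1) ^+ i *: l (u (lift ord_max i)) (f (omit (lift ord_max i) u))
  + (-1) ^+ n.+1 *: r (f (omit ord_max u)) (u ord_max)
  + \sum_(i < n.+1) \sum_(j < n | (i <= j)%N)
      (-1) ^+ i.+1 *: f (set_arg j (br (u i) (u (lift i j))) (omit i u)).

(** The Lie derivative L_x. *)
Definition lieder n (x : L) (f : ('I_n -> L) -> M) (a : 'I_n -> L) : M :=
  l x (f a) - \sum_(j < n) f (set_arg j (br x (a j)) a).

Lemma ld0 (f : ('I_0 -> L) -> M) u :
  ld f u = - r (f (omit ord_max u)) (u ord_max).
Proof.
rewrite /ld big_ord0 add0r expr1 scaleN1r big1 ?addr0 // => i _.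
by rewrite big_ord0.
Qed.

(* Cartan's formula: [i_x d = L_x - d i_x]. *)
Lemma ins_ld n x (f : ('I_n.+1 -> L) -> M) :
  ins x (ld f) = lieder x f - ld (ins x f).
Proof.
apply/funext => a; rewrite /ins /lieder /ld /= addrfctE opprfctE.
rewrite big_ord_recl expr0 scale1r lift_max0 cons_arg_ord0 omit0_cons_arg.
rewrite [X in _ + X = _]big_ord_recl /= expr1.
(* The terms with i = 0 bracket x with each entry; together with the term i = 0 of the first sum
   they form L_x f. *)
have -> : \sum_(j < n.+1 | (0 <= j)%N) -1 *:
     f (set_arg j (br (cons_arg x a ord0) (cons_arg x a (lift ord0 j)))
          (omit ord0 (cons_arg x a))) =
   - \sum_(j < n.+1) f (set_arg j (br x (a j)) a).
  rewrite -sumrN; apply: eq_bigr => j _.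
  by rewrite cons_arg_ord0 cons_arg_lift omit0_cons_arg scaleN1r.
under eq_bigr => i _ do
  rewrite lift_max_lift cons_arg_lift omit_cons_arg exprS mulN1r scaleNr.
rewrite sumrN -lift0_max omit_cons_arg cons_arg_lift exprS mulN1r scaleNr.
(* For positive i the index j = 0 is excluded, so both indices drop by one, at the cost of a
   sign. *)
have E (i : 'I_n.+1) : \sum_(j < n.+1 | (lift ord0 i <= j)%N)
     (-1) ^+ (lift ord0 i).+1 *: f (set_arg j
        (br (cons_arg x a (lift ord0 i)) (cons_arg x a (lift (lift ord0 i) j)))
        (omit (lift ord0 i) (cons_arg x a))) =
   - \sum_(j < n | (i <= j)%N) (-1) ^+ i.+1 *:
        f (cons_arg x (set_arg j (br (a i) (a (lift i j))) (omit i a))).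
  rewrite big_mkcond big_ord_recl /= add0r -big_mkcond /= -sumrN.
  apply: eq_bigr => j _.
  by rewrite lift_lift !cons_arg_lift omit_cons_arg set_arg_cons_arg
             [(-1) ^+ _]exprS mulN1r scaleNr.
rewrite (eq_bigr _ (fun i _ => E i)) sumrN.
zmod.
Qed.

(** The relation [L_x, i_y] = i_[x,y]: the extra term of L_x is the one that brackets x with the
    inserted y. *)
Lemma lieder_ins n x y (f : ('I_n.+1 -> L) -> M) :
  lieder x (ins y f) = ins y (lieder x f) + ins (br x y) f.
Proof.
apply/funext => a; rewrite addrfctE /ins /lieder big_ord_recl.
rewrite cons_arg_ord0 set_arg0_cons_arg.
under [X in _ = _ - (_ + X) + _]eq_bigr => j _ do
  rewrite cons_arg_lift set_arg_cons_arg.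
zmod.
Qed.

Hypothesis l_linear : forall x, linear (l x).

Lemma lieder_linear n x : linear (@lieder n x).
Proof.
move=> a f h; apply/funext => u.
rewrite /lieder !(addrfctE, scalrfctE) (l_linear x) scalerBr big_split /=.
by rewrite -scaler_sumr; zmod.
Qed.

Hypothesis r_linearl : forall y, linear (r^~ y).

Lemma ld_linear n : linear (@ld n).
Proof.
move=> a f h; apply/funext => u; rewrite /ld !(addrfctE, scalrfctE).
under eq_bigr => i _ do rewrite (l_linear _) scalerDr scalerA mulrC -scalerA.
rewrite big_split /= -scaler_sumr (r_linearl _) scalerDr scalerA mulrC -scalerA.
under [X in _ + _ + X = _]eq_bigr => i _.
  under eq_bigr => j _ do rewrite scalerDr scalerA mulrC -scalerA.
  rewrite big_split /= -scaler_sumr.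
  over.
rewrite big_split /= -scaler_sumr !scalerDr.
by zmod.
Qed.

End Differential.

(** * Leibniz bimodules and the vanishing of d d *)

Section Bimodule.
Variables (K : fieldType) (L M : lmodType K).
Variables (br : L -> L -> L) (l : L -> M -> M) (r : M -> L -> M).

(* [br] is a left Leibniz bracket; [M] is a bimodule with left action [l] and
   right action [r]. *)
Record leibniz_bimodule : Prop := LeibnizBimodule {
  br_linearl : forall y, linear (br^~ y);
  br_linearr : forall x, linear (br x);
  l_linearl : forall m, linear (l^~ m);
  l_linearr : forall x, linear (l x);
  r_linearl : forall y, linear (r^~ y);
  r_linearr : forall m, linear (r m);
  br_br : forall x y z, br x (br y z) = br (br x y) z + br y (br x z);
  l_br : forall x y m, l (br x y) m = l x (l y m) - l y (l x m);
  r_br : forall x y m, r m (br x y) = l x (r m y) - r (l x m) y;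
  r_lDr : forall x y m, r (l x m + r m x) y = 0
}.

Hypothesis bimod : leibniz_bimodule.

Local Notation ld := (ld br l r).
Local Notation lieder := (lieder br l).
Let l_lin := l_linearr bimod.
Let r_lin := r_linearl bimod.

(** In degree 0 this is the axiom [l_br]. Otherwise contract with z and move i_z inward by
    [L_x, i_z] = i_[x,z]; the inserted brackets match by the Leibniz identity. *)
Lemma lieder_comm n x y (f : ('I_n -> L) -> M) : multilinear f ->
  lieder (br x y) f = lieder x (lieder y f) - lieder y (lieder x f).
Proof.
elim: n => [|n IH] in x y f *; move=> mf.
  apply/funext => a; rewrite addrfctE opprfctE /lieder !big_ord0 !subr0.
  exact: l_br.
have linsE (z w : L) (h : ('I_n.+1 -> L) -> M) :
    ins w (lieder z h) = lieder z (ins w h) - ins (br z w) h.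
  by rewrite (lieder_ins br l); zmod.
apply: eq_ins => z; have mz := ins_multilinear z mf.
rewrite -[RHS]/(ins z (lieder x _) - ins z (lieder y _)) !linsE.
rewrite !(linear_predB (lieder_linear br l_lin _) (lieder _ _)).
rewrite IH // (br_br bimod x) (linear_predD (ins_linear mf)).
by zmod.
Qed.

Lemma lieder_multilinear n x (f : ('I_n -> L) -> M) :
  multilinear f -> multilinear (lieder x f).
Proof.
move=> mf i a; apply: linear_predB_fun.
  by move=> c u v; rewrite mf (l_lin x).
apply: linear_pred_sum_fun => j _.
have [->|nij] := eqVneq j i.
  move=> c u v; rewrite !set_arg_eq !set_arg_same (br_linearr bimod) mf.
  by [].
move=> c u v; rewrite !set_arg_neq // !(set_argC _ _ _ nij).
exact: mf.
Qed.

(** By Cartan's formula i_y d f = L_y f - d i_y f. Both terms are linear in y, which settles the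
    first entry; for the others, induction applies to i_y f. *)
Lemma ld_multilinear n (f : ('I_n -> L) -> M) :
  multilinear f -> multilinear (ld f).
Proof.
elim: n => [|n IH] in f *; move=> mf i a.
  move=> c u v; rewrite !ld0 !(args0_eq (omit ord_max _) (omit ord_max a)).
  rewrite !ord1 !set_arg_eq (r_linearr bimod).
  by rewrite scalerN; zmod.
have insE y x : ld f (cons_arg y x) = lieder y f x - ld (ins y f) x.
  by have /(congr1 (@^~ x)) := ins_ld br l r y f.
rewrite -[a]cons_arg_omit; move: (a _) (omit _ a) => {a} y a.
case: (unliftP ord0 i) => [j|] -> c u v; last first.
  rewrite !set_arg0_cons_arg !insE /lieder (ins_linear mf).
  rewrite (ld_linear br l_lin r_lin) (l_linearl bimod).
  under eq_bigr => k _ do rewrite (br_linearl bimod) mf.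
  rewrite big_split /= -scaler_sumr addrfctE scalrfctE !scalerBr.
  by zmod.
rewrite !set_arg_cons_arg !insE (lieder_multilinear y mf).
rewrite (IH _ (ins_multilinear y mf)) !scalerBr.
by zmod.
Qed.

(** After contraction with y, Cartan's formula leaves [L_x, L_y] f - L_[x,y] f and the same claim
    for i_y f. In degree 0 the claim is the axiom [r_br]. *)
Lemma lieder_ld n x (f : ('I_n -> L) -> M) :
  multilinear f -> lieder x (ld f) = ld (lieder x f).
Proof.
elim: n => [|n IH] in x f *; move=> mf.
  apply/funext => a.
  rewrite /lieder big_ord1 !ld0 (ord1 ord_max) set_arg_eq big_ord0 subr0.
  rewrite (args0_eq (omit ord0 (set_arg _ _ _)) (omit ord0 a)).
  rewrite (linear_predN (l_lin x)) (r_br bimod).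
  by zmod.
apply: eq_ins => y.
have linsE m (z w : L) (h : ('I_m.+1 -> L) -> M) :
    ins w (lieder z h) = lieder z (ins w h) - ins (br z w) h.
  by rewrite (lieder_ins br l); zmod.
rewrite linsE !ins_ld linsE.
rewrite (linear_predB (lieder_linear br l_lin _) (lieder _ _)).
rewrite (linear_predB (ld_linear br l_lin r_lin (n := n)) (lieder _ _)).
rewrite (IH _ _ (ins_multilinear y mf)) (lieder_comm _ _ mf).
by zmod.
Qed.

Lemma ld_ld n (f : ('I_n -> L) -> M) : multilinear f -> ld (ld f) = 0.
Proof.
elim: n => [|n IH] in f *; move=> mf; apply: eq_ins => x; rewrite ins_ld.
  (* A cochain of degree 0 has no contraction, so i_x d f is computed directly; [r_br] then reduces
     the goal to [r_lDr]. *)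
  have -> : ins x (ld f) = fun a => - r (f a) x.
    apply/funext => a; rewrite /ins ld0 (args0_eq (omit _ _) a).
    by rewrite ord1 cons_arg_ord0.
  apply/funext => a; rewrite addrfctE opprfctE /lieder big_ord1 !ld0.
  rewrite (ord1 ord_max) set_arg_eq.
  rewrite (args0_eq (omit ord0 (set_arg _ _ _)) (omit ord0 a)).
  rewrite (linear_predN (l_lin x)) (r_br bimod) (linear_predN (r_lin _)).
  have := r_lDr bimod x (a ord0) (f (omit ord0 a)).
  rewrite (linear_predD (r_lin _)) /ins => /eqP; rewrite addr_eq0 => /eqP E.
  by rewrite (_ : (0 : ('I_2 -> L) -> M) _ = 0) // E; zmod.
rewrite ins_ld.
rewrite (linear_predB (ld_linear br l_lin r_lin (n := n.+1)) (lieder _ _)).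
rewrite (IH _ (ins_multilinear x mf)) (lieder_ld _ mf) (_ : ins x 0 = 0) //.
by zmod.
Qed.

End Bimodule.

(** * Naturality of the differential in the algebra and in the coefficients *)

Section Naturality.
Variables (K : fieldType) (L L' M M' : lmodType K).

Lemma ld_comp (br : L -> L -> L) (br' : L' -> L' -> L')
    (l : L -> M -> M) (r : M -> L -> M) (phi : L' -> L) n
    (f : ('I_n -> L) -> M) u :
  (forall x y, br (phi x) (phi y) = phi (br' x y)) ->
  ld br' (l \o phi) (fun m => r m \o phi) (fun x => f (phi \o x)) u
  = ld br l r f (phi \o u).
Proof.
move=> phiM; congr (_ + _); apply: eq_bigr => i _; apply: eq_bigr => j _.
by rewrite comp_set_arg -phiM.
Qed.

Lemma ld_post (br : L -> L -> L) (l : L -> M -> M) (r : M -> L -> M)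
    (l' : L -> M' -> M') (r' : M' -> L -> M') (pi : M -> M') n
    (f : ('I_n -> L) -> M) u :
  linear pi ->
  (forall x m, pi (l x m) = l' x (pi m)) ->
  (forall m x, pi (r m x) = r' (pi m) x) ->
  pi (ld br l r f u) = ld br l' r' (pi \o f) u.
Proof.
move=> lpi pil pir; rewrite /ld !(linear_predD lpi) !(linear_pred_sum lpi).
rewrite (linear_predZ lpi) pir; congr (_ + _ + _); apply: eq_bigr => i _.
  by rewrite (linear_predZ lpi) pil.
rewrite (linear_pred_sum lpi); apply: eq_bigr => j _.
by rewrite (linear_predZ lpi).
Qed.

End Naturality.

(** * Alternating cochains with values in an antisymmetric bimodule *)

Section Antisymmetric.
Variables (K : fieldType) (L M : lmodType K).
Variables (br : L -> L -> L) (l : L -> M -> M).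

Local Notation r := (fun m x => - l x m).
Local Notation ld := (ld br l r).
Local Notation lieder := (lieder br l).

(** The right action term supplies the missing last summand of the first sum. *)
Lemma ld_antisymE n (f : ('I_n -> L) -> M) u :
  ld f u = \sum_(i < n.+1) (-1) ^+ i *: l (u i) (f (omit i u))
    + \sum_(i < n.+1) \sum_(j < n | (i <= j)%N)
      (-1) ^+ i.+1 *: f (set_arg j (br (u i) (u (lift i j))) (omit i u)).
Proof.
congr (_ + _); rewrite big_ord_recr /= exprS mulN1r scaleNr scalerN opprK.
congr (_ + _); apply: eq_bigr => i _.
by rewrite widen_lift.
Qed.

Hypothesis l_linear : forall x, linear (l x).
Hypothesis br_xx : forall x, br x x = 0.
Hypothesis br_anti : forall x y, br x y = - br y x.

Let r_linear y : linear (r^~ y).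
Proof. by move=> a u v; rewrite l_linear opprD scalerN. Qed.

Let l0 x : l x 0 = 0. Proof. exact: linear_pred0. Qed.

(* A sum over the positions of [x] reduces to the position [q], since the
   other summands contain [y] twice. *)
Lemma alternating_lie_sum n (f : ('I_n.+1 -> L) -> M) y z (x : 'I_n -> L) q :
  multilinear f -> alternating f -> x q = y ->
  \sum_(j < n) f (cons_arg y (set_arg j (br z (x j)) x))
    = f (cons_arg (br y z) x).
Proof.
move=> mf af xq; rewrite (bigD1 q) //= big1 ?addr0 => [|j njq].
  rewrite xq alternating_swap_cons // -xq set_arg_id br_anti.
  by rewrite -/(ins _ f _) (linear_predN (ins_linear mf)) opprK.
apply: (af _ ord0 (lift ord0 q)) => //.
by rewrite cons_arg_ord0 cons_arg_lift set_arg_neq // eq_sym.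
Qed.

(** If entries i and j agree, the summands at other positions vanish and those at i and j cancel by
    a transposition. *)
Lemma lieder_alternating n x (f : ('I_n -> L) -> M) :
  multilinear f -> alternating f -> alternating (lieder x f).
Proof.
move=> mf af a i j nij aij; rewrite /lieder (af a i j) // l0 sub0r.
have nji : j != i by rewrite eq_sym.
rewrite (bigD1 i) //= (bigD1 j) //= big1 ?addr0; last first.
  move=> k /andP[ki kj].
  by apply: (af _ i j); rewrite // !set_arg_neq // eq_sym.
have := alternating_swap (br x (a i)) (a i) a mf af nij.
rewrite {2}aij set_arg_id => ->.
by rewrite set_argC // set_arg_id aij addNr oppr0.
Qed.

(** By Cartan's formula this says that d f vanishes at (y, x) whenever y is an entry of x. The
    induction removes the head z of x. *)
Lemma ld_ins_repeated n (f : ('I_n.+1 -> L) -> M) y x q :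
  multilinear f -> alternating f -> x q = y ->
  ld (ins y f) x = lieder y f x.
Proof.
elim: n => [|n IH] in f x q *; move=> mf af.
  rewrite (ord1 q) => xq.
  rewrite ld0 /lieder big_ord1 xq br_xx (linear_pred0 (mf _ _)) subr0 opprK.
  by rewrite (ord1 ord_max) xq /ins -[X in cons_arg X]xq cons_arg_omit.
rewrite -[x]cons_arg_omit; move: (x _) (omit _ x) => {x} z x.
have -> : ld (ins y f) (cons_arg z x) =
    lieder z (ins y f) x - ld (ins z (ins y f)) x.
  by have /(congr1 (@^~ x)) := ins_ld br l r z (ins y f).
have linsE w : lieder y f (cons_arg w x) =
    lieder y (ins w f) x - f (cons_arg (br y w) x).
  have /(congr1 (@^~ x)) := lieder_ins br l y w f.
  by rewrite addrfctE /ins => ->; zmod.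
case: (unliftP ord0 q) => [k|] ->; last first.
  rewrite cons_arg_ord0 => ->.
  (* Here z = y, and the double contraction vanishes. *)
  have -> : ins y (ins y f) = 0.
    apply/funext => u; apply: (af _ ord0 (lift ord0 ord0)) => //.
    by rewrite cons_arg_ord0 cons_arg_lift cons_arg_ord0.
  rewrite (linear_pred0 (ld_linear br l_linear r_linear (n := n))) subr0.
  rewrite linsE br_xx -[f (cons_arg 0 x)]/(ins 0 f x).
  by rewrite (linear_pred0 (ins_linear mf)) subr0.
rewrite cons_arg_lift => xk.
(* Exchanging the contractions makes the induction hypothesis for i_z f applicable, since y is still
   an entry of the tail. *)
have -> : ins z (ins y f) = - ins y (ins z f).
  apply/funext => u.
  have := alternating_swap_cons ord0 y z (cons_arg 0 u) mf af.
  by rewrite !set_arg0_cons_arg.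
rewrite (linear_predN (ld_linear br l_linear r_linear (n := n))).
rewrite opprfctE.
rewrite (IH _ _ _ (ins_multilinear z mf) (ins_alternating z af) xk) linsE.
have -> : lieder z (ins y f) x = - f (cons_arg (br y z) x).
  rewrite {1}/lieder /ins (af _ ord0 (lift ord0 k)) ?l0 //; last first.
    by rewrite cons_arg_ord0 cons_arg_lift.
  by rewrite (alternating_lie_sum z mf af xk) sub0r.
by zmod.
Qed.

(** If neither of the equal entries is the head, Cartan's formula and induction apply; otherwise
    [ld_ins_repeated] does. *)
Lemma ld_alternating n (f : ('I_n -> L) -> M) :
  multilinear f -> alternating f -> alternating (ld f).
Proof.
elim: n => [|n IH] in f *; move=> mf af x i j.
  by rewrite !ord1 eqxx.
have insE y u : ld f (cons_arg y u) = lieder y f u - ld (ins y f) u.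
  by have /(congr1 (@^~ u)) := ins_ld br l r y f.
rewrite -[x]cons_arg_omit; move: (x _) (omit _ x) => {x} y x.
case: (unliftP ord0 i) (unliftP ord0 j) => [i'|] -> [j'|] ->.
- rewrite (inj_eq lift_inj) !cons_arg_lift insE => nij xij.
  rewrite (lieder_alternating _ mf af nij xij).
  have := IH _ (ins_multilinear y mf) (ins_alternating y af) x _ _ nij xij.
  by move->; rewrite subr0.
- rewrite cons_arg_lift cons_arg_ord0 => _ xq.
  by rewrite insE (ld_ins_repeated mf af xq) subrr.
- rewrite cons_arg_lift cons_arg_ord0 => _ /esym xq.
  by rewrite insE (ld_ins_repeated mf af xq) subrr.
by rewrite eqxx.
Qed.

End Antisymmetric.

(** * Lie representations and the hemisemidirect product *)

Section LieRepresentation.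
Variables (K : fieldType) (g : lieAlgebra K) (V : lmodType K).
Variable rho : lieRep g V.

Lemma lie_anti (x y : g) : [[x, y]] = - [[y, x]].
Proof.
apply/eqP; rewrite -addr_eq0; apply/eqP.
have := lie_brxx (x + y).
by rewrite linearDl !linearDr !lie_brxx add0r addr0.
Qed.

Lemma lie_leibniz (x y z : g) :
  [[x, [[y, z]]]] = [[[[x, y]], z]] + [[y, [[x, z]]]].
Proof.
have := lie_jacobi x y z.
rewrite (lie_anti z x) (lie_anti z) linearNr -!addrA => /eqP.
by rewrite addr_eq0 => /eqP ->; zmod.
Qed.

Lemma lie_linearr (x : g) : linear (@lie_br K g x).
Proof. by move=> a u v; rewrite linearPr. Qed.

Lemma rep_linearr (x : g) : linear (rho x).
Proof. by move=> a u v; rewrite linearPr. Qed.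

Lemma ld_lie_antisym n (f : ('I_n -> g) -> g) :
  ld (@lie_br K g) (@lie_br K g) (@lie_br K g) f =
  ld (@lie_br K g) (@lie_br K g) (fun m y => - [[y, m]]) f.
Proof. by apply/funext => x; rewrite /ld (lie_anti (f _)). Qed.

(** The Chevalley-Eilenberg formula puts [x_i, x_j] first, [ld] puts it in the place of x_j; the
    cycle between the two accounts for the difference in sign. *)
Lemma dCE_ld n (f : ('I_n.+1 -> g) -> g) : multilinear f -> alternating f ->
  dCE f = ld (@lie_br K g) (@lie_br K g) (@lie_br K g) f.
Proof.
move=> mf af; apply/funext => x.
rewrite ld_lie_antisym ld_antisymE /dCE; congr (_ + _).
apply: eq_bigr => i _; apply: eq_bigr => j _.
rewrite alternating_cycle // scalerA.
by rewrite -addSn exprD -mulrA -expr2 sqrr_sign mulr1.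
Qed.

(* Hemisemidirect product. *)
Definition hemi_br (X Y : g * V) : g * V := ([[X.1, Y.1]], rho X.1 Y.2).

Lemma hemi_leibniz X Y Z :
  hemi_br X (hemi_br Y Z) = hemi_br (hemi_br X Y) Z + hemi_br Y (hemi_br X Z).
Proof.
by congr (_, _) => /=; [exact: lie_leibniz | rewrite rep_br; zmod].
Qed.

Lemma hemi_bimodule : leibniz_bimodule hemi_br hemi_br hemi_br.
Proof.
have hl Y : linear (hemi_br^~ Y).
  by move=> a X Z; congr (_, _); rewrite /= linearPl.
have hr X : linear (hemi_br X).
  by move=> a Y Z; congr (_, _); rewrite /= linearPr.
split=> //.
- exact: hemi_leibniz.
- by move=> X Y Z; rewrite [hemi_br X (hemi_br Y Z)]hemi_leibniz; zmod.
- by move=> X Y Z; rewrite [hemi_br X (hemi_br Z Y)]hemi_leibniz; zmod.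
(* The brackets of X with Z in both orders add up to an element with zero g-component, and such an
   element acts by zero from the left. *)
move=> X Y Z; rewrite /hemi_br /= (lie_anti X.1) addNr.
by rewrite !linear0l.
Qed.

Definition total n (f : preC_rep g V n) (X : 'I_n.+1 -> g * V) : g * V :=
  (f.1 (fst \o X), f.2 (fst \o omit ord_max X) (X ord_max).2).

(** A test list from which the V-component of [total f] recovers [f.2 x v]; that component ignores
    the zeros. *)
Definition snoc_arg n (x : 'I_n -> g) (v : V) (k : 'I_n.+1) : g * V :=
  if unlift ord_max k is Some l then (x l, 0) else (0, v).

Lemma snoc_arg_max n (x : 'I_n -> g) v : snoc_arg x v ord_max = (0, v).
Proof. by rewrite /snoc_arg unlift_none. Qed.

Lemma omit_snoc_arg n (x : 'I_n -> g) v :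
  fst \o omit ord_max (snoc_arg x v) = x.
Proof. by apply/funext => k; rewrite /= /omit /snoc_arg liftK. Qed.

Lemma total_fst n (f : preC_rep g V n) x :
  f.1 x = (total f (fun k => (x k, 0))).1.
Proof. by []. Qed.

Lemma total_snd n (f : preC_rep g V n) x v :
  f.2 x v = (total f (snoc_arg x v)).2.
Proof. by rewrite /total /= omit_snoc_arg snoc_arg_max. Qed.

(** Identities between pairs can thus be checked on their totals, where the theory of [ld]
    applies. *)
Lemma total_inj n : injective (@total n).
Proof.
move=> f h E; rewrite [f]surjective_pairing [h]surjective_pairing.
congr (_, _); apply/funext => x; first by rewrite !total_fst E.
by apply/funext => v; rewrite !total_snd E.
Qed.

Lemma C_rep0 n : C_rep (0 : preC_rep g V n).
Proof.
split=> //.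
- by move=> i x a u v; rewrite /= scaler0 addr0.
- by move=> w i x a u v; rewrite /= scaler0 addr0.
by move=> x a u v; rewrite /= scaler0 addr0.
Qed.

Lemma C_rep_linear n a (b c : preC_rep g V n) :
  C_rep b -> C_rep c -> C_rep (a *: b + c).
Proof.
case=> m1 a1 m2 a2 l2 [m1' a1' m2' a2' l2']; split.
- move=> i x; exact: linear_predD_fun (linear_predZ_fun a (m1 i x)) (m1' i x).
- move=> x i j nij xij; rewrite /= addrfctE scalrfctE.
  by rewrite (a1 x i j) // (a1' x i j) // scaler0 addr0.
- move=> v i x.
  exact: linear_predD_fun (linear_predZ_fun a (m2 v i x)) (m2' v i x).
- move=> v x i j nij xij; rewrite /= !addrfctE !scalrfctE.
  by rewrite (a2 v x i j) // (a2' v x i j) // scaler0 addr0.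
by move=> x; exact: linear_predD_fun (linear_predZ_fun a (l2 x)) (l2' x).
Qed.

Lemma total_linear n : linear (@total n).
Proof. by []. Qed.

Lemma pair_linearl a (u v : g) :
  (a *: u + v, 0) = a *: (u, 0) + (v, 0) :> g * V.
Proof. by congr (_, _); rewrite /= scaler0 addr0. Qed.

Lemma pair_linearr a (u v : V) :
  (0, a *: u + v) = a *: (0, u) + (0, v) :> g * V.
Proof. by congr (_, _); rewrite /= scaler0 addr0. Qed.

(** The three linearity conditions merge into one on [total f]. Alternation stays on the components,
    since [total f] itself need not be alternating. *)
Lemma C_repP n (f : preC_rep g V n) : C_rep f <->
  [/\ multilinear (total f), alternating f.1
    & forall v, alternating (f.2^~ v)].
Proof.
split=> [ [m1 a1 m2 a2 l2] | [mt a1 a2] ]; split=> //.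
- move=> i X a u v; congr (_, _) => /=; first by rewrite !comp_set_arg m1.
  case: (unliftP ord_max i) => [j|] ->.
    rewrite !omit_max_set_arg !comp_set_arg.
    by rewrite !(set_arg_neq _ _ (neq_lift _ _)) (m2 _ j).
  by rewrite !omit_max_set_arg_max !set_arg_eq l2.
- move=> i x a u v.
  have E w : f.1 (set_arg i w x) =
      (total f (set_arg i (w, 0) (fun k => (x k, 0)))).1.
    by rewrite /total comp_set_arg.
  by rewrite !E pair_linearl mt.
- move=> w i x a u v.
  have E z : f.2 (set_arg i z x) w =
      (total f (set_arg (lift ord_max i) (z, 0) (snoc_arg x w))).2.
    rewrite /total /= omit_max_set_arg comp_set_arg omit_snoc_arg.
    by rewrite set_arg_neq ?neq_lift // snoc_arg_max.
  by rewrite !E pair_linearl mt.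
move=> x a u v.
have E w : f.2 x w = (total f (set_arg ord_max (0, w) (snoc_arg x 0))).2.
  by rewrite /total omit_max_set_arg_max omit_snoc_arg set_arg_eq.
by rewrite !E pair_linearr mt.
Qed.

(** The commutator of rho(x) with phi, for arbitrary maps phi from V to V; [f.2] becomes a cochain
    with values in such maps. *)
Definition end_act (x : g) (phi : V -> V) : V -> V :=
  fun v => rho x (phi v) - phi (rho x v).

Lemma end_act_linear x : linear (end_act x).
Proof.
move=> a phi psi; apply/funext => v.
rewrite /end_act !(addrfctE, scalrfctE) linearPr scalerBr.
by zmod.
Qed.

(** With the term in [f.1] split off, alternation of the rest is an instance of [ld_alternating]. *)
Lemma delta_VE n (f : preC_rep g V n) x v :
  delta_V rho f x v =
    ld (@lie_br K g) end_act (fun m y => - end_act y m) f.2 x v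
    + (-1) ^+ n *: rho (f.1 x) v.
Proof.
rewrite ld_antisymE /delta_V addrfctE !fct_sumE.
under [X in _ = _ + X + _]eq_bigr => i _ do rewrite fct_sumE.
by zmod.
Qed.

Lemma delta_V_alternating n (f : preC_rep g V n) v :
  C_rep f -> alternating ((delta_V rho f)^~ v).
Proof.
case=> m1 a1 m2 a2 l2 x i j nij xij; rewrite delta_VE (a1 _ i j) //.
rewrite linear0l scaler0 addr0.
have mf : multilinear (f.2 : ('I_n -> g) -> (V -> V)).
  by move=> k y a u w; apply/funext => z; rewrite !(addrfctE, scalrfctE) m2.
have af : alternating (f.2 : ('I_n -> g) -> (V -> V)).
  by move=> y k l nkl ykl; apply/funext => z; exact: (a2 z y k l).
by rewrite (ld_alternating end_act_linear (@lie_brxx K g) lie_anti mf af nij).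
Qed.

(** The g-components agree by naturality under the projection to g. The V-components are compared
    termwise, the right action giving the term in [f.1]. *)
Lemma ld_total n (f : preC_rep g V n) : C_rep f ->
  ld hemi_br hemi_br hemi_br (total f) = total (delta rho f).
Proof.
case=> m1 a1 _ _ _; apply/funext => X.
rewrite [LHS]surjective_pairing; congr (_, _).
  rewrite (@ld_post _ _ _ _ _ _ _ ((@lie_br K g) \o fst)
    (fun m Y => [[m, Y.1]]) fst) //.
  rewrite [RHS]/= dCE_ld //.
  rewrite -(@ld_comp _ _ (g * V)%type _ _ hemi_br _ _ fst) //.
have sndL : linear (snd : g * V -> V) by [].
rewrite /ld !(linear_predD sndL) !(linear_pred_sum sndL).
rewrite /delta /delta_V [RHS]/=.
(* The last i of the double sum admits no j. *)
rewrite [X in _ + X = _]big_ord_recr /=.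
rewrite [X in _ + (_ + X) = _](linear_pred_sum sndL).
rewrite [X in _ + (_ + X) = _]big1 => [|j]; last by have := ltn_ord j; lia.
rewrite addr0.
set x := fst \o omit ord_max X; set v := (X ord_max).2.
(* The last j brackets the i-th entry with the last argument, which produces the terms where
   rho(x_i) acts on v inside [f.2]. *)
have E (i : 'I_n.+1) :
    (\sum_(j < n.+1 | (i <= j)%N) (-1) ^+ i.+1 *: total f
       (set_arg j (hemi_br (X (widen_ord (leqnSn n.+1) i))
          (X (lift (widen_ord (leqnSn n.+1) i) j)))
          (omit (widen_ord (leqnSn n.+1) i) X))).2 =
    \sum_(j < n | (i <= j)%N)
       (-1) ^+ i.+1 *: f.2 (set_arg j [[x i, x (lift i j)]] (omit i x)) v
    + (-1) ^+ i.+1 *: f.2 (omit i x) (rho (x i) v).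
  rewrite (linear_pred_sum sndL) big_mkcond big_ord_recr -big_mkcond /=.
  rewrite -ltnS ltn_ord widen_lift lift_max_max.
  rewrite omit_max_set_arg_max omit_max_omit comp_omit set_arg_eq /=.
  congr (_ + _); apply: eq_bigr => j _.
  rewrite widen_lift lift_max_lift_max omit_max_set_arg omit_max_omit.
  rewrite comp_set_arg comp_omit set_arg_neq ?neq_lift //.
  by rewrite omit_lift_max.
rewrite (eq_bigr _ (fun i _ => E i)) big_split /=.
under eq_bigr => i _ do rewrite omit_max_omit comp_omit omit_lift_max.
under [X in _ = _ + X]eq_bigr => i _ do rewrite scalerBr.
rewrite sumrB.
rewrite !exprS !mulN1r opprK -/x -/v.
have -> : \sum_(i < n.+1) (-1) ^+ i.+1 *: f.2 (omit i x) (rho (x i) v) =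
    - \sum_(i < n.+1) (-1) ^+ i *: f.2 (omit i x) (rho (x i) v).
  by rewrite -sumrN; apply: eq_bigr => i _; rewrite exprS mulN1r scaleNr.
by zmod.
Qed.

End LieRepresentation.

(** * The Leibniz algebra V of an embedding tensor and its bimodule g *)

Section LieLeibnizTriple.
Variables (K : fieldType) (g : lieAlgebra K) (V : lmodType K).
Variable rho : lieRep g V.
Variable T : {linear V -> g}.
Hypothesis hT : embedding_tensor rho T.

Definition tensor_br (u v : V) : V := rho (T u) v.
Definition tensor_l (u : V) (x : g) : g := [[T u, x]].
(** The image in the quotient of the bracket ([x, Tu], rho(x) u) of (x, 0) with (Tu, u). *)
Definition tensor_r (x : g) (u : V) : g := [[x, T u]] - T (rho x u).

Lemma tensor_bimodule : leibniz_bimodule tensor_br tensor_l tensor_r.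
Proof.
split.
- by move=> v a u w; rewrite /tensor_br linearP linearPl.
- by move=> u; exact: rep_linearr.
- by move=> x a u w; rewrite /tensor_l linearP linearPl.
- by move=> u; exact: lie_linearr.
- move=> u a x y; rewrite /tensor_r !linearPl linearP scalerBr /=.
  by zmod.
- move=> x a u w; rewrite /tensor_r linearP !linearPr linearP scalerBr /=.
  by zmod.
- by move=> u v w; rewrite /tensor_br -hT rep_br; zmod.
- by move=> u v x; rewrite /tensor_l /tensor_br -hT lie_leibniz; zmod.
- move=> u v x; rewrite /tensor_l /tensor_r /tensor_br rep_br linearBr.
  by rewrite lie_leibniz !(linearB T) !hT /=; zmod.
(* The two actions of u on x add up to - T (rho x u), and by [hT] the right action vanishes on the
   image of T. *)
move=> u v x; rewrite /tensor_l /tensor_r (lie_anti x) addrA subrr add0r.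
by rewrite linearNl hT linearNl linearN /=; zmod.
Qed.

Lemma partial_TE k (theta : preC_T g V k) :
  partial_T rho T theta = ld tensor_br tensor_l tensor_r theta.
Proof.
apply/funext => u; rewrite /ld /partial_T /tensor_r scalerBr -!addrA.
by rewrite exprS mulN1r !scaleNr opprK.
Qed.

Definition graph (u : V) : g * V := (T u, u).
Definition graph_quot (X : g * V) : g := X.1 - T X.2.

Lemma graph_quot_linear : linear graph_quot.
Proof.
by move=> a X Y; rewrite /graph_quot /= linearP scalerBr /=; zmod.
Qed.

(* [graph] embeds the Leibniz algebra [V] in the hemisemidirect product and
   [graph_quot] identifies [g] with the quotient bimodule. *)
Lemma Omega_TE n (f : preC_rep g V n) :
  Omega_T T f = (-1) ^+ n.+1 *: (fun v => graph_quot (total f (graph \o v))).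
Proof. by []. Qed.

Lemma Omega_linear n : linear (@Omega_T K g V T n).
Proof.
move=> a f h; rewrite !Omega_TE scalerA mulrC -scalerA -scalerDr.
congr (_ *: _).
by apply/funext => v; rewrite total_linear graph_quot_linear.
Qed.

(** Both kinds of naturality at once: by [hT], [graph] is a homomorphism and [graph_quot] is
    compatible with both actions. *)
Lemma ld_graph_quot n (F : ('I_n -> g * V) -> g * V) :
  ld tensor_br tensor_l tensor_r (fun v => graph_quot (F (graph \o v))) =
  fun v =>
    graph_quot (ld (hemi_br rho) (hemi_br rho) (hemi_br rho) F (graph \o v)).
Proof.
apply/funext => v.
rewrite -(@ld_comp _ _ _ _ _ tensor_br); last first.
  by move=> x y; congr (_, _); rewrite /= hT.
rewrite (@ld_post _ _ _ _ _ _ _ tensor_l tensor_r graph_quot) //.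
- exact: graph_quot_linear.
- by move=> u X; rewrite /graph_quot /tensor_l /= linearBr hT.
move=> X u; rewrite /graph_quot /tensor_r /= !linearBl hT linearB /=.
by zmod.
Qed.

Lemma delta_C n (f : preC_rep g V n) : C_rep f -> C_rep (delta rho f).
Proof.
move=> Cf; have [m1 a1 _ _ _] := Cf; have [mt _ _] := (C_repP f).1 Cf.
apply/C_repP; split.
- by rewrite -ld_total //; exact: (ld_multilinear (hemi_bimodule rho)).
- rewrite /= dCE_ld //.
  rewrite ld_lie_antisym; apply: ld_alternating => //.
  + exact: lie_linearr.
  + exact: lie_brxx.
  + exact: lie_anti.
by move=> v; exact: delta_V_alternating.
Qed.

Lemma Omega_C n (f : preC_rep g V n) : C_rep f -> C_T (Omega_T T f).
Proof.
case/C_repP => mt _ _ i x; rewrite Omega_TE; apply: linear_predZ_fun.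
move=> a u v; rewrite !comp_set_arg -graph_quot_linear -mt.
congr (graph_quot (total f (set_arg _ _ _))).
by congr (_, _); rewrite /= linearP.
Qed.

End LieLeibnizTriple.

(** * The cochain complex *)

Theorem theorem5p3 (K : fieldType) (g : lieAlgebra K) (V : lmodType K)
    (rho : lieRep g V) (T : {linear V -> g}) (hT : embedding_tensor rho T) :
  cochain_complex (@C K g V) (@D K g V rho T).
Proof.
(* Linearity of [delta] is inherited from [ld] through [ld_total], hence stated on cochains. *)
have deltaP n a (b c : preC_rep g V n) : C_rep b -> C_rep c ->
    delta rho (a *: b + c) = a *: delta rho b + delta rho c.
  move=> Cb Cc; apply: total_inj; have bm := hemi_bimodule rho.
  rewrite [RHS]total_linear -!ld_total //; last exact: C_rep_linear.
  by rewrite total_linear (ld_linear _ (l_linearr bm) (r_linearl bm)).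
have tm := tensor_bimodule hT.
have partialP n : linear (@partial_T K g V rho T n).
  move=> a b c; rewrite !partial_TE.
  exact: (ld_linear _ (l_linearr tm) (r_linearl tm)).
have C10 : C (0 : preC g V 1).
  split; first exact: C_rep0.
  by move=> i x a u v; rewrite /= scaler0 addr0.
split.
- case=> [//|n] /=; split; first exact: C_rep0.
  by move=> i x a u v; rewrite /= scaler0 addr0.
- case=> [//|n] a b c /= [Cb mb] [Cc mc]; split; first exact: C_rep_linear.
  by move=> i x; exact: linear_predD_fun (linear_predZ_fun a (mb i x)) (mc i x).
- case=> [|n] c; first by move=> _; exact: C10.
  case=> Cc mc; split; first exact: delta_C.
  move=> i x; apply: linear_predD_fun; last exact: Omega_C.
  by rewrite partial_TE; exact: (ld_multilinear tm).
- case=> [|n] a b c; first by rewrite /= scaler0 addr0.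
  move=> /= [Cb mb] [Cc mc]; congr (_, _); first exact: deltaP.
  by rewrite partialP Omega_linear addrACA -scalerDr.
have delta0 n : delta rho 0 = 0 :> preC_rep g V n.+1.
  have := deltaP n (-1) 0 0 (C_rep0 g V n) (C_rep0 g V n).
  by rewrite !scaleN1r oppr0 addr0 addNr.
case=> [|n] c.
  move=> _ /=; congr (_, _); first exact: delta0.
  rewrite (linear_pred0 (@partialP _)) add0r Omega_TE; apply/funext => v.
  by rewrite scalrfctE /= /graph_quot /total /= linear0 subr0 scaler0.
move=> [Cc mc]; have [mt _ _] := (C_repP c.1).1 Cc; congr (_, _).
  apply: total_inj; rewrite -ld_total; last exact: delta_C.
  by rewrite -ld_total // (ld_ld (hemi_bimodule rho)).
(* There remains the sum of [partial_T] of Omega f and Omega of [delta] f. By [ld_graph_quot] these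
   are the same function with the opposite signs (-1)^(n+1) and (-1)^(n+2). *)
rewrite /= (linear_predD (@partialP _)) !partial_TE (ld_ld tm) // add0r.
have ldL := ld_linear (tensor_br rho T) (l_linearr tm) (r_linearl tm).
rewrite !Omega_TE (linear_predZ (@ldL n.+1)) (ld_graph_quot hT) ld_total //.
by rewrite [(-1) ^+ n.+2]exprS mulN1r scaleNr subrr.
Qed.
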